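(* Let $A\in\mathbb{C}^{n\times n}$ be positive definite with eigenvalues $\lambda_1\geq\lambda_2\geq\ldots\geq\lambda_n>0$, and let $D\in\mathbb{C}^{m\times m}$ be a Hermitian matrix with eigenvalues $\mu_1\leq\mu_2\leq\ldots\leq\mu_r\leq 0<\mu_{r+1}\leq\ldots\leq\mu_m$ (in both cases counted with multiplicities). Assume that $$r\leq n\quad\text{and}\quad \lambda_i+\mu_i>0\ \text{ for } i=1,\ldots,r.$$ Then there exists a strictly contractive matrix $K\in\mathbb{C}^{n\times m}$ such that the matrix $$S=\begin{bmatrix}A&-AK\\ K^*A&D\end{bmatrix}$$ is a $J$-frame matrix which is similar to a Hermitian matrix. In this case, all eigenvalues of $S$ are positive and there exists a basis of $\mathbb{C}^{n+m}$ consisting of eigenvectors of $S$.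
   Context: A matrix $K$ is strictly contractive if $\|K\|<1$, where $\|K\|$ denotes the spectral norm (largest singular value) of $K$. A block matrix $S=\left[\begin{smallmatrix}A&-AK\\ K^*A&D\end{smallmatrix}\right]\in\mathbb{C}^{(n+m)\times(n+m)}$ is called a $J$-frame matrix if $A\in\mathbb{C}^{n\times n}$ is positive definite, $K\in\mathbb{C}^{n\times m}$ is strictly contractive, and $D\in\mathbb{C}^{m\times m}$ is a Hermitian matrix such that $D+K^*AK$ is positive definite. *)

(* Defs.v *)
From mathcomp Require Import all_boot all_order all_algebra.
From mathcomp Require Import complex.
From mathcomp Require Import reals.

Set Implicit Arguments.
Unset Strict Implicit.
Unset Printing Implicit Defensive.

Import Order.TTheory GRing.Theory Num.Theory.

Local Open Scope ring_scope.
Local Open Scope complex_scope.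
Local Open Scope sesquilinear_scope.

(* The field of complex numbers is R[i] for R : realType. On R[i], [0 < z]    *)
(* means that z is real and positive, and [M ^t*] is the conjugate transpose. *)
(* Sizes 0 are allowed throughout.                                            *)

Definition posdefmx (R : realType) (n : nat) (A : 'M[R[i]]_n) : Prop :=
  A \is hermsymmx /\
  forall x : 'cV[R[i]]_n, x != 0 -> 0 < (x ^t* *m A *m x) 0 0.

(* The list [a] consists of all eigenvalues of A, which are real, counted     *)
(* with algebraic multiplicity.                                               *)
Definition has_eigenvalues (R : realType) (n : nat) (A : 'M[R[i]]_n)
    (a : 'I_n -> R) : Prop :=
  char_poly A = \prod_(i < n) ('X - ((a i)%:C)%:P).

(* For Hermitian H, [spectral_diag H] lists the eigenvalues of H with         *)
(* multiplicities; those of K ^t* *m K are real and nonnegative. If n < m the *)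
(* list is the usual one with m - n zeros added.                              *)
Definition singular_value (R : realType) (n m : nat) (K : 'M[R[i]]_(n, m))
    (j : 'I_m) : R :=
  Num.sqrt (complex.Re (spectral_diag (K ^t* *m K) 0 j)).

(* The largest singular value, and 0 if m = 0. *)
Definition spectral_norm (R : realType) (n m : nat) (K : 'M[R[i]]_(n, m)) : R :=
  \big[Num.max/0]_(j < m) singular_value K j.

Definition strictly_contractive (R : realType) (n m : nat)
    (K : 'M[R[i]]_(n, m)) : Prop :=
  spectral_norm K < 1.

Definition jblock_mx (R : realType) (n m : nat)
    (A : 'M[R[i]]_n) (K : 'M[R[i]]_(n, m)) (D : 'M[R[i]]_m) :
    'M[R[i]]_(n + m) :=
  block_mx A (- (A *m K)) (K ^t* *m A) D.

Definition jframe_mx (R : realType) (n m : nat) (S : 'M[R[i]]_(n + m)) : Prop :=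
  exists (A : 'M[R[i]]_n) (K : 'M[R[i]]_(n, m)) (D : 'M[R[i]]_m),
    [/\ S = jblock_mx A K D,
        posdefmx A,
        strictly_contractive K,
        D \is hermsymmx &
        posdefmx (D + K ^t* *m A *m K)].

Definition similar_to_hermitian (R : realType) (n : nat)
    (S : 'M[R[i]]_n) : Prop :=
  exists2 H : 'M[R[i]]_n, H \is hermsymmx & similar_in unitmx S H.

(* The library's [eigenvalue] is about row vectors and has the same values;   *)
(* the eigenvectors here are column vectors.                                  *)
Definition eigenvector (R : realType) (n : nat) (S : 'M[R[i]]_n)
    (v : 'cV[R[i]]_n) : Prop :=
  v != 0 /\ exists a : R[i], S *m v = a *: v.

Definition has_eigenvector_basis (R : realType) (n : nat)
    (S : 'M[R[i]]_n) : Prop :=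
  exists2 b : seq 'cV[R[i]]_n,
    basis_of fullv b & forall v, v \in b -> eigenvector S v.

(* Main.v *)
Require Import Defs.
From mathcomp Require Import all_boot all_order all_algebra.
From mathcomp Require Import complex.
From mathcomp Require Import fingroup perm.
From mathcomp Require Import reals.
From mathcomp Require Import ring lra.

(** That [S = block_mx A (- A K) (K^* A) D] has positive eigenvalues and an
    eigenbasis holds for every J-frame matrix which is similar to a Hermitian
    matrix.  The similarity makes [S] diagonalizable with real eigenvalues
    ([similar_to_hermitian_diag]).  For their sign, multiply on the right by
    the unipotent matrix [F = block_mx 1 (2K) 0 1]: then [S F] is Hermitian,
    and positive definite because its Schur complement is [D + K^* A K], while
    [F + F^* = 2 (block_mx 1 K K^* 1)] is positive definite because [K] is a
    strict contraction.  If [v S = x v] for a row vector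
    [v] and [x] real, then taking real parts
    in [v (S F) v^* = x (v F v^* )] shows that [x] is a quotient of positive
    numbers ([jframe_eigenvalue_gt0]).

    For the existence of [K], diagonalize [A] in a basis [U] and [D] in a
    basis [V].  Let [W] be the partial isometry that sends the first [r]
    vectors of [V] to the first [r] vectors of [U], and look for [K = W k]
    with [k] diagonal in [V].  Then [S] splits into 2x2 blocks
    [[l, - l k], [l k, m]], one for each pair [(lambda_i, mu_i)] with [i < r],
    and 1x1 blocks, which are eigenvalues of [A] or positive eigenvalues
    of [D].  A 2x2 block is a J-frame matrix if [- m / l < k ^ 2 < 1], and it
    has distinct real eigenvalues if [k < (1 - m / l) / 2].  As
    [t := - m / l] lies in [[0, 1)], the strict inequality
    [sqrt t < (1 + t) / 2] leaves room for such a [k]; see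
    [coupling_exists], where the hypothesis [0 < l + m] is used.

    Similarity to a Hermitian matrix is not read off from the blocks.  It is
    enough to find a positive definite [H] with [H S] Hermitian
    ([similar_to_hermitian_posdef]), and [H = block_mx 1 Q Q^* 1] with
    [Q = W q], [q] diagonal in [V], works as soon as [q (m - l) = 2 l k] for
    each pair ([coupling_hermitian]).  The bound [k < (1 - m / l) / 2] says
    exactly that [q ^ 2 < 1], that is, that [H] is positive definite. *)

Set Implicit Arguments.
Unset Strict Implicit.
Unset Printing Implicit Defensive.

Import Order.TTheory GRing.Theory Num.Theory.

Local Open Scope ring_scope.
Local Open Scope complex_scope.
Local Open Scope sesquilinear_scope.

(** * Adjoints and Hermitian forms *)

Lemma adjmxM (C : numClosedFieldType) m n p (A : 'M[C]_(m, n)) (B : 'M_(n, p)) :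
  (A *m B) ^t* = B ^t* *m A ^t*.
Proof. by rewrite trmx_mul map_mxM. Qed.

Lemma adjmxD (C : numClosedFieldType) m n (A B : 'M[C]_(m, n)) :
  (A + B) ^t* = A ^t* + B ^t*.
Proof. by rewrite linearD /= map_mxD. Qed.

Lemma adjmxN (C : numClosedFieldType) m n (A : 'M[C]_(m, n)) :
  (- A) ^t* = - A ^t*.
Proof. by rewrite linearN /= map_mxN. Qed.

Lemma adjmx1 (C : numClosedFieldType) n : (1%:M : 'M[C]_n) ^t* = 1%:M.
Proof. by rewrite trmx1 map_mx1. Qed.

Lemma adjmx0 (C : numClosedFieldType) m n : (0 : 'M[C]_(m, n)) ^t* = 0.
Proof. by rewrite trmx0 map_mx0. Qed.

Lemma adjmx_block (C : numClosedFieldType) m1 m2 n1 n2 (A : 'M[C]_(m1, n1))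
    (B : 'M_(m1, n2)) (B' : 'M_(m2, n1)) (D : 'M_(m2, n2)) :
  (block_mx A B B' D) ^t* = block_mx (A ^t*) (B' ^t*) (B ^t*) (D ^t*).
Proof. by rewrite tr_block_mx map_block_mx. Qed.

Definition adjmxE := (adjmxM, adjmxD, adjmxN, adjmx1, adjmx0, @trmxCK).

Lemma hermP (C : numClosedFieldType) n (A : 'M[C]_n) :
  reflect (A ^t* = A) (A \is hermsymmx).
Proof.
apply: (iffP (is_hermitianmxP _ _ _)); rewrite expr0 scale1r.
  by move=> {2}->.
by move=> ->.
Qed.

Lemma adj_entry00 (C : numClosedFieldType) (M : 'M[C]_1) :
  (M ^t*) 0 0 = Num.conj (M 0 0).
Proof. by rewrite !mxE. Qed.

Lemma herm_form_real (C : numClosedFieldType) n (H : 'M[C]_n) (v : 'rV_n) :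
  H \is hermsymmx -> (v *m H *m v ^t*) 0 0 \is Num.real.
Proof.
by move=> /hermP hH; apply/CrealP; rewrite -adj_entry00 !adjmxE hH mulmxA.
Qed.

(** * Positive definite matrices *)

Lemma posdefmx_row (R : realType) n (A : 'M[R[i]]_n) (v : 'rV_n) :
  posdefmx A -> v != 0 -> 0 < (v *m A *m v ^t*) 0 0.
Proof.
move=> [_ posA] v0; have := posA (v ^t*); rewrite trmxCK; apply.
by apply: contraNneq v0 => v0; rewrite -(trmxCK v) v0 adjmx0.
Qed.

Lemma posdefmx1 (R : realType) n : posdefmx (1%:M : 'M[R[i]]_n).
Proof.
split=> [|x x0]; first by apply/hermP; rewrite adjmx1.
rewrite mulmx1 !mxE lt_def sumr_ge0 ?andbT => [|i _]; last first.
  by rewrite !mxE mulrC mul_conjC_ge0.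
apply: contraNneq x0 => /eqP; rewrite psumr_eq0 => [|i _]; last first.
  by rewrite !mxE mulrC mul_conjC_ge0.
move=> /allP x0; apply/eqP/colP => i; rewrite mxE.
have := x0 i (mem_index_enum i); rewrite !mxE mulrC mul_conjC_eq0.
by move/eqP.
Qed.

Lemma posdefmx_congr (R : realType) n (A P : 'M[R[i]]_n) :
  P \in unitmx -> posdefmx A -> posdefmx (P ^t* *m A *m P).
Proof.
move=> uP [/hermP hA posA]; split=> [|x x0].
  by apply/hermP; rewrite !adjmxE hA mulmxA.
have := posA (P *m x); rewrite !adjmxE !mulmxA; apply.
apply: contraNneq x0 => /(congr1 (mulmx (invmx P))).
by rewrite mulKmx // mulmx0 => ->.
Qed.

Lemma posdefmx_diag_block (R : realType) n m (A : 'M[R[i]]_n) (E : 'M_m) :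
  posdefmx A -> posdefmx E -> posdefmx (block_mx A 0 0 E).
Proof.
move=> [/hermP hA posA] [/hermP hE posE]; split=> [|x].
  by apply/hermP; rewrite adjmx_block !adjmx0 hA hE.
rewrite -[x]vsubmxK; move: (usubmx x) (dsubmx x) => {x} x y xy0.
rewrite tr_col_mx map_row_mx mul_row_block mul_row_col !mulmx0 addr0 add0r mxE.
have geA (z : 'cV_n) : 0 <= (z ^t* *m A *m z) 0 0.
  have [->|z0] := eqVneq z 0; first by rewrite mulmx0 mxE.
  exact: ltW (posA _ z0).
have geE (z : 'cV_m) : 0 <= (z ^t* *m E *m z) 0 0.
  have [->|z0] := eqVneq z 0; first by rewrite mulmx0 mxE.
  exact: ltW (posE _ z0).
have [x0|x0] := eqVneq x 0; last by rewrite ltr_wpDr ?posA.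
rewrite ltr_wpDl // posE //; apply: contraNneq xy0 => y0.
by rewrite x0 y0 col_mx0.
Qed.

(** The block matrix is congruent, by [block_mx 1 X 0 1], to the block diagonal
    matrix of [A] and its Schur complement [E]. *)
Lemma posdefmx_block (R : realType) n m (A : 'M[R[i]]_n) (E : 'M_m)
    (X : 'M_(n, m)) :
  posdefmx A -> posdefmx E ->
  posdefmx (block_mx A (A *m X) (X ^t* *m A) (E + X ^t* *m A *m X)).
Proof.
move=> pA pE.
have uP : block_mx 1%:M X 0 1%:M \in unitmx.
  by rewrite unitmxE det_ublock !det1 mulr1 unitr1.
have := posdefmx_congr uP (posdefmx_diag_block pA pE).
rewrite adjmx_block !adjmxE !mulmx_block.
by rewrite !(mul1mx, mulmx1, mul0mx, mulmx0, addr0, add0r) addrC.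
Qed.

(** * Functions of a Hermitian matrix *)

Definition uconj (C : numClosedFieldType) n (V M : 'M[C]_n) : 'M[C]_n :=
  V ^t* *m M *m V.

Lemma uconjD (C : numClosedFieldType) n (V M N : 'M[C]_n) :
  uconj V M + uconj V N = uconj V (M + N).
Proof. by rewrite /uconj mulmxDr mulmxDl. Qed.

Lemma uconjN (C : numClosedFieldType) n (V M : 'M[C]_n) :
  - uconj V M = uconj V (- M).
Proof. by rewrite /uconj mulmxN mulNmx. Qed.

Lemma uconjM (C : numClosedFieldType) n (V M N : 'M[C]_n) : V \is unitarymx ->
  uconj V M *m uconj V N = uconj V (M *m N).
Proof. by move=> uV; rewrite /uconj !mulmxA mulmxtVK. Qed.

Lemma uconj_adj (C : numClosedFieldType) n (V M : 'M[C]_n) :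
  (uconj V M) ^t* = uconj V (M ^t*).
Proof. by rewrite /uconj !adjmxE mulmxA. Qed.

Lemma uconj1 (C : numClosedFieldType) n (V : 'M[C]_n) : V \is unitarymx ->
  uconj V 1%:M = 1%:M.
Proof.
by move=> uV; rewrite /uconj mulmx1 -(invmx_unitary uV) mulVmx // unitarymx_unit.
Qed.

Definition rdiag (R : realType) n (f : 'I_n -> R) : 'M[R[i]]_n :=
  diag_mx (\row_j (f j)%:C).

(** The real functions of a Hermitian matrix diagonalized by [V]: for a fixed
    [V] these matrices form a commutative algebra, in which sums and products
    are computed pointwise. *)
Definition fdiag (R : realType) n (V : 'M[R[i]]_n) (f : 'I_n -> R) : 'M[R[i]]_n :=
  uconj V (rdiag f).

Lemma fdiag_adj (R : realType) n (V : 'M[R[i]]_n) f : (fdiag V f) ^t* = fdiag V f.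
Proof.
rewrite /fdiag uconj_adj; congr uconj.
apply/matrixP => i j; rewrite !mxE rmorphMn /= eq_sym.
by case: eqVneq => [->|]; rewrite ?mulr0n // !mulr1n; apply: conjc_real.
Qed.

Lemma eq_fdiag (R : realType) n (V : 'M[R[i]]_n) f g :
  f =1 g -> fdiag V f = fdiag V g.
Proof.
by move=> fg; rewrite /fdiag; congr uconj; apply/matrixP=> i j; rewrite !mxE fg.
Qed.

Lemma fdiagD (R : realType) n (V : 'M[R[i]]_n) f g :
  fdiag V f + fdiag V g = fdiag V (fun j => f j + g j).
Proof.
rewrite /fdiag uconjD; congr uconj; apply/matrixP=> i j.
by rewrite !mxE rmorphD mulrnDl.
Qed.

Lemma fdiagN (R : realType) n (V : 'M[R[i]]_n) f :
  - fdiag V f = fdiag V (fun j => - f j).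
Proof.
rewrite /fdiag uconjN; congr uconj; apply/matrixP=> i j.
by rewrite !mxE rmorphN mulNrn.
Qed.

Lemma fdiagM (R : realType) n (V : 'M[R[i]]_n) f g : V \is unitarymx ->
  fdiag V f *m fdiag V g = fdiag V (fun j => f j * g j).
Proof.
move=> uV; rewrite /fdiag (uconjM _ _ uV) mulmx_diag; congr uconj.
by apply/matrixP=> i j; rewrite !mxE rmorphM.
Qed.

Lemma fdiag1 (R : realType) n (V : 'M[R[i]]_n) : V \is unitarymx ->
  1%:M = fdiag V (fun=> 1).
Proof.
move=> uV; rewrite -(uconj1 uV) /fdiag; congr uconj.
by apply/matrixP => i j; rewrite !mxE.
Qed.

Lemma fdiag_sqrt (R : realType) n (V : 'M[R[i]]_n) f : V \is unitarymx ->
  (forall j, 0 < f j) ->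
  exists2 T, T \in unitmx & fdiag V f = T ^t* *m T.
Proof.
move=> uV f_gt0; exists (fdiag V (fun j => Num.sqrt (f j))).
  have fK : fdiag V (fun j => Num.sqrt (f j)) *m
            fdiag V (fun j => (Num.sqrt (f j))^-1) = 1%:M; last first.
    exact: proj1 (mulmx1_unit fK).
  rewrite (fdiagM _ _ uV) (fdiag1 uV); apply: eq_fdiag => j.
  by rewrite divff // gt_eqF // sqrtr_gt0.
rewrite fdiag_adj (fdiagM _ _ uV); apply: eq_fdiag => j.
by rewrite -expr2 sqr_sqrtr // ltW.
Qed.

(** The eigenvectors are the columns of [V^*]; conversely, a matrix [T^* T] with
    [T] invertible is congruent to the identity. *)
Lemma posdefmx_fdiag (R : realType) n (V : 'M[R[i]]_n) f : V \is unitarymx ->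
  posdefmx (fdiag V f) <-> forall j, 0 < f j.
Proof.
move=> uV; split=> [[_ pos] j|f_gt0].
  pose e : 'cV[R[i]]_n := delta_mx j 0.
  have Ve0 : V ^t* *m e != 0.
    apply/eqP => /(congr1 (mulmx V)); rewrite mulmxA (unitarymxP uV) mul1mx mulmx0.
    by move/matrixP/(_ j 0)/eqP; rewrite !mxE !eqxx oner_eq0.
  have := pos _ Ve0.
  rewrite /fdiag /uconj !adjmxE !mulmxA !mulmxtVK // mul_mx_diag.
  rewrite mxE (bigD1 j) //= big1 => [|k /negPf kj]; last first.
    by rewrite !mxE kj mulr0.
  by rewrite !mxE !eqxx rmorph1 mul1r mulr1 addr0 ltcR.
have [T uT ->] := fdiag_sqrt uV f_gt0.
by rewrite -[T ^t*]mulmx1; apply: posdefmx_congr uT (posdefmx1 _ _).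
Qed.

Lemma adjmx_unit (C : numClosedFieldType) n (A : 'M[C]_n) :
  (A ^t* \in unitmx) = (A \in unitmx).
Proof. by rewrite map_unitmx unitmx_tr. Qed.

Lemma fdiag_row_perm (R : realType) n (V : 'M[R[i]]_n) (s : 'S_n) f :
  fdiag (row_perm s V) (f \o s) = fdiag V f.
Proof.
apply/matrixP => i j; rewrite /fdiag /uconj /rdiag !mul_mx_diag !mxE.
by rewrite [RHS](reindex_inj (@perm_inj _ s)); apply: eq_bigr => k _; rewrite !mxE.
Qed.

Lemma herm_spectral (R : realType) n (A : 'M[R[i]]_n) : A \is hermsymmx ->
  A = fdiag (spectralmx A) (fun j => complex.Re (spectral_diag A 0 j)).
Proof.
move=> hA; rewrite {1}(orthomx_spectralP (hermitian_normalmx hA)).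
rewrite (invmx_unitary (spectral_unitarymx A)).
rewrite /fdiag /uconj /rdiag (_ : \row__ _ = spectral_diag A) //.
apply/rowP => j; rewrite mxE RRe_real //.
by move/mxOverP: (hermitian_spectral_diag_real hA).
Qed.

Lemma char_poly_fdiag (R : realType) n (V : 'M[R[i]]_n) f : V \is unitarymx ->
  char_poly (fdiag V f) = \prod_(j < n) ('X - ((f j)%:C)%:P).
Proof.
move=> uV.
have -> : char_poly (fdiag V f) = char_poly (rdiag f).
  rewrite /fdiag; move: (rdiag f) => D; have := uconj1 uV.
  rewrite /uconj mulmx1 => VV; rewrite /char_poly /char_poly_mx.
  have -> : 'X%:M - map_mx polyC (V ^t* *m D *m V) =
     map_mx polyC (V ^t*) *m ('X%:M - map_mx polyC D) *m map_mx polyC V.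
    rewrite !map_mxM mulmxBr mulmxBl; congr (_ - _).
    by rewrite mul_mx_scalar -scalemxAl -map_mxM /= VV map_mx1 scalemx1.
  by rewrite !det_mulmx mulrAC -det_mulmx -map_mxM /= VV map_mx1 det1 mul1r.
rewrite char_poly_trig ?diag_mx_is_trig //.
by apply: eq_bigr => j _; rewrite !mxE eqxx.
Qed.

(** The spectral theorem orders the eigenvalues in its own way, but both lists
    are the roots of the characteristic polynomial, so they differ by a
    permutation, which can be absorbed in the unitary matrix. *)
Lemma herm_diag_listed (R : realType) n (A : 'M[R[i]]_n) a :
  A \is hermsymmx -> has_eigenvalues A a ->
  exists2 V, V \is unitarymx & A = fdiag V a.
Proof.
move=> hA eA; pose V := spectralmx A.
pose d j := complex.Re (spectral_diag A 0 j).
have uV : V \is unitarymx by apply: spectral_unitarymx.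
have AE : A = fdiag V d by apply: herm_spectral.
have : perm_eq [tuple (a j)%:C | j < n] [tuple (d j)%:C | j < n].
  apply: prod_XsubC_eq; rewrite !big_tuple.
  under eq_bigr do rewrite tnth_mktuple.
  under [RHS]eq_bigr do rewrite tnth_mktuple.
  by rewrite -eA -(char_poly_fdiag d uV) -AE.
case/tuple_permP => s sE.
have ad j : a j = d (s j).
  have := congr1 (fun t => nth 0 t j) sE.
  by rewrite /= !nth_mktuple tnth_mktuple; case.
exists (row_perm s V).
  apply/unitarymxP/matrixP => i k.
  have /matrixP/(_ (s i) (s k)) := unitarymxP uV.
  rewrite !mxE (inj_eq perm_inj) => <-.
  by apply: eq_bigr => l _; rewrite !mxE.
rewrite AE -(fdiag_row_perm V s); apply: eq_fdiag => j /=; by rewrite ad.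
Qed.

Lemma posdefmx_sqrt (R : realType) n (H : 'M[R[i]]_n) : posdefmx H ->
  exists2 T, T \in unitmx & H = T ^t* *m T.
Proof.
move=> pH; have HE := herm_spectral (proj1 pH).
have uV := spectral_unitarymx H.
move: pH; rewrite {1}HE posdefmx_fdiag // => d_gt0.
by rewrite HE; apply: fdiag_sqrt.
Qed.

Lemma posdefmx_unit (R : realType) n (H : 'M[R[i]]_n) : posdefmx H -> H \in unitmx.
Proof.
case/posdefmx_sqrt=> T uT ->; by rewrite unitmx_mul adjmx_unit uT.
Qed.

(** In the eigenbasis of [K^* K], the matrix [1 - K^* K] is diagonal with
    entries [1 - s ^ 2], for [s] the singular values. *)
Lemma strictly_contractiveP (R : realType) n m (K : 'M[R[i]]_(n, m)) :
  strictly_contractive K <-> posdefmx (1%:M - K ^t* *m K).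
Proof.
have hK : K ^t* *m K \is hermsymmx by apply/hermP; rewrite !adjmxE.
have uV := spectral_unitarymx (K ^t* *m K).
rewrite [X in _ - X](herm_spectral hK) (fdiag1 uV) fdiagN fdiagD posdefmx_fdiag //.
rewrite /strictly_contractive /spectral_norm /singular_value.
split=> [/bigmax_ltP[_ lt1] j|lt1].
  rewrite subr_gt0; have := lt1 j isT; rewrite -[X in _ < X -> _]sqrtr1.
  by rewrite ltr_sqrt.
apply/bigmax_ltP; split=> // j _.
by rewrite -[ltRHS]sqrtr1 ltr_sqrt // -subr_gt0 lt1.
Qed.

(** * Similarity to a Hermitian matrix *)

(** Writing [H = T^* T], the conjugate of [S] by [T] is congruent to [H S] by
    [T^-1].  In other words, [S] is self-adjoint for the inner product defined
    by [H]. *)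
Lemma similar_to_hermitian_posdef (R : realType) n (H S : 'M[R[i]]_n) :
  posdefmx H -> H *m S \is hermsymmx -> similar_to_hermitian S.
Proof.
case/posdefmx_sqrt=> T uT -> /hermP hTS.
exists (conjmx T S); last by exists T => //; apply/eqP.
apply/hermP; rewrite conjumx //.
have -> : T *m S *m invmx T = (invmx T) ^t* *m (T ^t* *m T *m S) *m invmx T.
  by rewrite !mulmxA -adjmxM mulmxV // adjmx1 mul1mx.
move: (T ^t* *m T *m S) hTS => M hM.
by rewrite !adjmxM trmxCK hM mulmxA.
Qed.

Lemma similar_to_hermitian_diag (R : realType) n (S : 'M[R[i]]_n) :
  similar_to_hermitian S ->
  exists B d, B \in unitmx /\ S *m B = B *m rdiag d.
Proof.
case=> H hH [P uP /eqP]; rewrite conjumx // => PSP.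
have := herm_spectral hH; have := spectral_unitarymx H.
move: (spectralmx H) (fun j => _) => V d uV HE.
exists (invmx P *m V ^t*), d; split.
  by rewrite unitmx_mul unitmx_inv uP adjmx_unit unitarymx_unit.
have -> : S = invmx P *m H *m P.
  by rewrite -PSP -!mulmxA mulVmx // mulmx1 mulKmx.
rewrite HE /fdiag /uconj !mulmxA (mulmxK uP).
by rewrite mulmxtVK.
Qed.

Lemma similar_to_hermitian_real (R : realType) n (S : 'M[R[i]]_n) a :
  similar_to_hermitian S -> eigenvalue S a -> exists x : R, a = x%:C.
Proof.
case/similar_to_hermitian_diag=> B [d [uB SB]] /eigenvalueP[u uS u0].
have uB0 : u *m B != 0.
  apply: contraNneq u0 => /(congr1 (mulmx^~ (invmx B))).
  by rewrite mulmxK // mul0mx => ->.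
have [j uBj] : exists j, (u *m B) 0 j != 0.
  apply/existsP; apply: contraNT uB0 => /existsPn uB0.
  by apply/eqP/rowP => j; rewrite [RHS]mxE; apply/eqP; rewrite -[_ == _]negbK.
exists (d j); apply: (mulIf uBj).
have : u *m B *m rdiag d = a *: (u *m B) by rewrite -mulmxA -SB mulmxA uS scalemxAl.
move/rowP/(_ j); rewrite mul_mx_diag mxE [X in _ = X]mxE => <-.
by rewrite mulrC !mxE.
Qed.

Lemma similar_to_hermitian_basis (R : realType) n (S : 'M[R[i]]_n) :
  similar_to_hermitian S -> has_eigenvector_basis S.
Proof.
case/similar_to_hermitian_diag=> B [d [uB SB]].
exists [tuple col j B | j < n].
  rewrite basisEfree subvf dimvf size_tuple dim_matrix mulr1.
  rewrite leqnn !andbT.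
  apply/freeP => c; under eq_bigr do rewrite nth_mktuple.
  move=> c0 j; have Bc : B *m (\col_k c k) = 0.
    rewrite -c0; apply/colP => k; rewrite summxE mxE; apply: eq_bigr => l _.
    by rewrite !mxE mulrC.
  have : \col_k c k = 0 by rewrite -(mulKmx uB (\col_k c k)) Bc mulmx0.
  by move/colP/(_ j); rewrite !mxE.
move=> v /mapP[j _ ->]; split.
  apply/eqP => /(congr1 (mulmx (invmx B))).
  rewrite mulmx0 colE mulmxA mulVmx // mul1mx.
  by move/matrixP/(_ j 0)/eqP; rewrite !mxE !eqxx oner_eq0.
exists (d j)%:C; rewrite colE mulmxA SB -!colE; apply/colP => k.
by rewrite mxE mul_mx_diag !mxE mulrC.
Qed.

(** * Eigenvalues of a J-frame matrix *)

(** The data in a J-frame decomposition are determined by the matrix, because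
    [A] is invertible. *)
Lemma jframe_posdef (R : realType) n m (A : 'M[R[i]]_n) (K : 'M_(n, m)) (D : 'M_m) :
  jframe_mx (jblock_mx A K D) -> posdefmx (D + K ^t* *m A *m K).
Proof.
case=> A' [K' [D' [/eq_block_mx[<- + _ <-] pA _ _ pD]]].
move=> /oppr_inj/(congr1 (mulmx (invmx A))).
rewrite !(mulKmx (posdefmx_unit pA)) => ->; exact: pD.
Qed.

(** The factor [F] makes the form of [S F] Hermitian positive and has positive
    real part itself, so a real eigenvalue is the ratio of the two. *)
Lemma jframe_eigenvalue_gt0 (R : realType) n m (A : 'M[R[i]]_n) (K : 'M_(n, m))
    (D : 'M_m) (x : R) :
  posdefmx A -> posdefmx (1%:M - K ^t* *m K) -> posdefmx (D + K ^t* *m A *m K) ->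
  eigenvalue (jblock_mx A K D) x%:C -> 0 < x.
Proof.
move=> pA pK pD /eigenvalueP[v vS v0].
pose F : 'M[R[i]]_(n + m) := block_mx 1%:M (K + K) 0 1%:M.
have SF : posdefmx (jblock_mx A K D *m F).
  suff -> : jblock_mx A K D *m F =
      block_mx A (A *m K) (K ^t* *m A) (D + K ^t* *m A *m K + K ^t* *m A *m K).
    exact: posdefmx_block.
  rewrite /jblock_mx /F mulmx_block !(mulmx1, mulmx0, addr0, mulmxDr) addrK.
  by rewrite addrC addrA.
have FF : posdefmx (block_mx 1%:M K (K ^t* ) 1%:M).
  by have := posdefmx_block K (posdefmx1 R n) pK; rewrite !(mul1mx, mulmx1) subrK.
have FE : F + F ^t* = block_mx 1%:M K (K ^t* ) 1%:M *+ 2.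
  rewrite /F adjmx_block !adjmxE add_block_mx mulr2n add_block_mx.
  by rewrite add0r addr0.
have E : v *m (jblock_mx A K D *m F) *m v ^t* = x%:C *: (v *m F *m v ^t*).
  by rewrite mulmxA vS -!scalemxAl.
have xreal : Num.conj x%:C = x%:C by apply: conjc_real.
have SFr := herm_form_real v (proj1 SF).
have := posdefmx_row FF v0; have := posdefmx_row SF v0.
set p := (X in 0 < X -> _) => p0; set g := (X in 0 < X -> _) => g0.
have pE : p = x%:C * (v *m F *m v ^t*) 0 0 by rewrite /p E mxE.
have gE : (v *m F *m v ^t*) 0 0 + (v *m F ^t* *m v ^t*) 0 0 = g *+ 2.
  transitivity ((v *m (F + F ^t* ) *m v ^t* ) 0 0).
    by rewrite mulmxDr mulmxDl [RHS]mxE.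
  by rewrite FE !mulr2n mulmxDr mulmxDl [LHS]mxE.
have pg : p *+ 2 = x%:C * (g *+ 2).
  rewrite mulr2n -{2}(CrealP SFr : Num.conj p = p) pE rmorphM /= xreal.
  by rewrite -adj_entry00 !adjmxE mulmxA -mulrDr gE.
clearbody p g.
have : 0 < x%:C * (g *+ 2) by rewrite -pg pmulrn_lgt0.
by rewrite pmulr_lgt0 ?pmulrn_lgt0 // ltcR.
Qed.

(** * Construction of the contraction *)

(** With [s ^ 2 = - m / l], the conditions on [k] amount to
    [s < k < (1 + s ^ 2) / 2]; the interval has length [(1 - s) ^ 2 / 2]. *)
Lemma coupling_exists (R : realType) (l m : R) : 0 < l -> m <= 0 -> 0 < l + m ->
  exists k q : R, [/\ k ^+ 2 < 1, q ^+ 2 < 1, 0 < m + l * k ^+ 2 &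
    q * (m - l) = l * k *+ 2].
Proof.
move=> l0 m0 lm.
have t0 : 0 <= - m / l by rewrite divr_ge0 ?oppr_ge0 // ltW.
pose s := Num.sqrt (- m / l).
have s0 : 0 <= s := sqrtr_ge0 _.
have mE : m = - (l * s ^+ 2).
  by rewrite sqr_sqrtr //; field; rewrite gt_eqF.
have s1 : s < 1.
  by rewrite -[ltRHS]sqrtr1 ltr_sqrt // ltr_pdivrMr // mul1r; lra.
have s2 : 0 < 1 + s ^+ 2 by nra.
(* the midpoint of s and (1 + s ^ 2) / 2 *)
pose k := (1 + s) ^+ 2 / 4.
have ks : s < k by rewrite /k; nra.
have k1 : k < (1 + s ^+ 2) / 2 by rewrite /k; nra.
have kk : k < 1 by nra.
exists k, (- (k *+ 2) / (1 + s ^+ 2)); split.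
- by nra.
- rewrite expr_div_n sqrrN ltr_pdivrMr ?exprn_gt0 // mul1r.
  by rewrite ltr_pXn2r // ?nnegrE; nra.
- have -> : m + l * k ^+ 2 = l * ((k - s) * (k + s)) by rewrite mE; ring.
  by rewrite !mulr_gt0 //; lra.
- by rewrite mE; field; rewrite gt_eqF.
Qed.

(** [W] maps the first [r] eigenvectors of the second matrix to those of the
    first one and kills the others; [l'] only has to agree with [l] on the
    matched indices. *)
Lemma partial_isometry_intertwining (R : realType) n m r (U : 'M[R[i]]_n)
    (V : 'M_m) (l : 'I_n -> R) (l' : 'I_m -> R) :
  U \is unitarymx -> V \is unitarymx -> (r <= n)%N ->
  (forall (i : 'I_n) (j : 'I_m), i = j :> nat -> (i < r)%N -> l i = l' j) ->
  let W := U ^t* *m pid_mx r *m V in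
  W ^t* *m W = fdiag V (fun j => (j < r)%N%:R) /\
  fdiag U l *m W = W *m fdiag V l'.
Proof.
move=> uU uV rn ll' W; have adjp : (pid_mx r : 'M[R[i]]_(n, m)) ^t* = pid_mx r.
  by rewrite tr_pid_mx map_pid_mx.
have pp : pid_mx r *m (pid_mx r : 'M[R[i]]_(n, m)) =
    rdiag (fun j : 'I_m => (j < r)%N%:R).
  rewrite pid_mx_id //; apply/matrixP => i j; rewrite !mxE rmorph_nat.
  by case: (i =P j) => [->|/val_eqP/negPf->]; rewrite ?eqxx.
have pl : rdiag l *m pid_mx r = pid_mx r *m rdiag l'.
  apply/matrixP => i j; rewrite mul_diag_mx mul_mx_diag !mxE.
  case: eqP => [ij|_]; last by rewrite mulr0 mul0r.
  case: ltnP => [ir|_]; last by rewrite mulr0 mul0r.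
  by rewrite mulr1 mul1r (ll' i j).
rewrite /W /fdiag; split.
  by rewrite !adjmxM adjp trmxCK -pp /uconj !mulmxA mulmxtVK.
move: (rdiag l) (rdiag l') pl => L L' pl.
by rewrite /uconj !mulmxA !mulmxtVK // -[_ *m L *m _]mulmxA pl mulmxA.
Qed.

(** Since [W^* A W = B L], everything built from [K = W k] is expressed
    by matrices that are diagonal in the same basis. *)
Lemma isometric_gram (C : numClosedFieldType) n m (A : 'M[C]_n) (W : 'M_(n, m))
    (B L k : 'M_m) :
  k ^t* = k -> W ^t* *m W = B -> A *m W = W *m L ->
  (W *m k) ^t* *m (W *m k) = k *m (B *m k) /\
  (W *m k) ^t* *m A *m (W *m k) = k *m (B *m (L *m k)).
Proof.
move=> hk <- AW; split; first by rewrite adjmxM hk !mulmxA.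
by rewrite adjmxM hk -!mulmxA; congr (_ *m (_ *m _)); rewrite !mulmxA AW.
Qed.

(** The 2x2 block identity behind the construction: the off-diagonal blocks of
    the product are [W (q D - L k)] and the adjoint of [W (L q + L k)], and the
    last equation makes them match; the commutation relations take care of the
    diagonal blocks. *)
Lemma coupling_hermitian (C : numClosedFieldType) n m (A : 'M[C]_n)
    (W : 'M_(n, m)) (B D L k q : 'M_m) :
  A ^t* = A -> D ^t* = D -> q ^t* = q -> (L *m k) ^t* = L *m k ->
  W ^t* *m W = B -> A *m W = W *m L ->
  q *m (L *m k) = L *m k *m q ->
  q *m (B *m (L *m k)) = L *m k *m (B *m q) ->
  q *m D - L *m k = L *m q + L *m k ->
  block_mx 1%:M (W *m q) ((W *m q) ^t*) 1%:M *m
  block_mx A (- (A *m (W *m k))) ((W *m k) ^t* *m A) D \is hermsymmx.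
Proof.
move=> hA hD hq hLk WW AW qLk qBLk qD; set K := W *m k; set Q := W *m q.
have AK : A *m K = W *m (L *m k) by rewrite /K mulmxA AW mulmxA.
have AQ : A *m Q = W *m (L *m q) by rewrite /Q mulmxA AW mulmxA.
have KA : K ^t* *m A = (A *m K) ^t* by rewrite [RHS]adjmxM hA.
have QA : Q ^t* *m A = (A *m Q) ^t* by rewrite [RHS]adjmxM hA.
have offd : - (A *m K) + Q *m D = A *m Q + A *m K.
  by rewrite AK AQ /Q -mulmxA -mulmxDr -qD mulmxBr addrC.
apply/hermP; rewrite mulmx_block !mul1mx adjmx_block offd KA.
congr block_mx.
- rewrite adjmxD hA; congr (_ + _); rewrite (adjmxM Q) trmxCK AK /Q.
  move: (L *m k) hLk qLk {qBLk qD AK} => M hM qM; rewrite !(adjmxM W) hM hq.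
  by rewrite -!mulmxA !(mulmxA _ _ (W ^t*)) qM.
- by rewrite adjmxD trmxCK QA trmxCK.
- by rewrite QA adjmxD.
rewrite adjmxD hD; congr (_ + _); rewrite mulmxN adjmxN; congr (- _).
have QAK : Q ^t* *m (A *m K) = q *m (B *m (L *m k)).
  by rewrite AK /Q adjmxM hq -WW !mulmxA.
have hB : B ^t* = B by rewrite -WW adjmxM trmxCK.
by rewrite QAK (adjmxM q) (adjmxM B) hq hB hLk qBLk !mulmxA.
Qed.

(** The inner product for which [S] is self-adjoint is [H = block_mx 1 Q Q^* 1]
    with [Q = W q]: the bound on [q] makes [H] positive definite, and the
    equation for [q] makes [H S] Hermitian. *)
Lemma similar_to_hermitian_coupling (R : realType) n m (A : 'M[R[i]]_n) (V : 'M_m)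
    (W : 'M_(n, m)) (b l k q mu : 'I_m -> R) :
  A \is hermsymmx -> V \is unitarymx ->
  W ^t* *m W = fdiag V b -> A *m W = W *m fdiag V l ->
  (forall j, 0 < 1 - q j * (b j * q j)) ->
  (forall j, q j * mu j - l j * k j = l j * q j + l j * k j) ->
  similar_to_hermitian (jblock_mx A (W *m fdiag V k) (fdiag V mu)).
Proof.
move=> /hermP hA uV WW AW q1 qk.
pose Q := W *m fdiag V q.
have pH : posdefmx (block_mx 1%:M Q (Q ^t* ) 1%:M).
  have pQ : posdefmx (1%:M - Q ^t* *m Q).
    have [-> _] := isometric_gram (fdiag_adj V q) WW AW.
    by rewrite !(fdiagM _ _ uV) (fdiag1 uV) fdiagN fdiagD posdefmx_fdiag.
  by have := posdefmx_block Q (posdefmx1 R n) pQ; rewrite !(mul1mx, mulmx1) subrK.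
apply: similar_to_hermitian_posdef pH _.
have hLk : (fdiag V l *m fdiag V k) ^t* = fdiag V l *m fdiag V k.
  by rewrite (fdiagM _ _ uV) fdiag_adj.
have qLk : fdiag V q *m (fdiag V l *m fdiag V k) =
    fdiag V l *m fdiag V k *m fdiag V q.
  by rewrite !(fdiagM _ _ uV); apply: eq_fdiag => j; rewrite mulrC.
have qBLk : fdiag V q *m (fdiag V b *m (fdiag V l *m fdiag V k)) =
    fdiag V l *m fdiag V k *m (fdiag V b *m fdiag V q).
  by rewrite !(fdiagM _ _ uV); apply: eq_fdiag => j; ring.
have qD : fdiag V q *m fdiag V mu - fdiag V l *m fdiag V k =
    fdiag V l *m fdiag V q + fdiag V l *m fdiag V k.
  by rewrite !(fdiagM _ _ uV) fdiagN !fdiagD; apply: eq_fdiag qk.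
exact: coupling_hermitian hA (fdiag_adj V mu) (fdiag_adj V q) hLk WW AW qLk qBLk qD.
Qed.

Theorem theorem5p4 (R : realType) (n m : nat)
    (A : 'M[R[i]]_n) (lambda : 'I_n -> R)
    (D : 'M[R[i]]_m) (mu : 'I_m -> R) (r : nat)
    (A_posdef : posdefmx A)
    (A_eig : has_eigenvalues A lambda)
    (lambda_decr : forall i j : 'I_n, (i <= j)%N -> lambda j <= lambda i)
    (lambda_gt0 : forall i : 'I_n, 0 < lambda i)
    (D_herm : D \is hermsymmx)
    (D_eig : has_eigenvalues D mu)
    (mu_incr : forall i j : 'I_m, (i <= j)%N -> mu i <= mu j)
    (r_le_m : (r <= m)%N)
    (mu_le0 : forall j : 'I_m, (j < r)%N -> mu j <= 0)
    (mu_gt0 : forall j : 'I_m, (r <= j)%N -> 0 < mu j)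
    (r_le_n : (r <= n)%N)
    (lambda_mu : forall (i : 'I_n) (j : 'I_m),
       i = j :> nat -> (i < r)%N -> 0 < lambda i + mu j) :
  (exists K : 'M[R[i]]_(n, m),
     [/\ strictly_contractive K,
         jframe_mx (jblock_mx A K D) &
         similar_to_hermitian (jblock_mx A K D)]) /\
  (forall K : 'M[R[i]]_(n, m),
     strictly_contractive K ->
     jframe_mx (jblock_mx A K D) ->
     similar_to_hermitian (jblock_mx A K D) ->
     (forall a : R[i], eigenvalue (jblock_mx A K D) a -> 0 < a) /\
     has_eigenvector_basis (jblock_mx A K D)).
Proof.
split=> [|K /strictly_contractiveP cK jS hS]; last first.
  split=> [a aS|]; last exact: similar_to_hermitian_basis.
  have [x xE] := similar_to_hermitian_real hS aS; move: aS; rewrite xE ltcR.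
  exact: jframe_eigenvalue_gt0 A_posdef cK (jframe_posdef jS).
have [U uU AE] := herm_diag_listed (proj1 A_posdef) A_eig.
have [V uV DE] := herm_diag_listed D_herm D_eig.
(* The default value 0 is taken only for j >= n, where no eigenvalue of A is
   paired with mu j. *)
pose l (j : 'I_m) := oapp lambda 0 (insub (nat_of_ord j)).
have lE (i : 'I_n) (j : 'I_m) : i = j :> nat -> lambda i = l j.
  by move=> ij; rewrite /l -ij valK.
have [W [WW AW]] : exists W : 'M[R[i]]_(n, m),
    W ^t* *m W = fdiag V (fun j => (j < r)%N%:R) /\ A *m W = W *m fdiag V l.
  exists (U ^t* *m pid_mx r *m V); rewrite AE.
  by apply: partial_isometry_intertwining => // i j /lE.
have /fin_all_exists[k /fin_all_exists[q kq]] : forall j : 'I_m, exists k q : R,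
    [/\ 0 < 1 - k * ((j < r)%N%:R * k), 0 < 1 - q * ((j < r)%N%:R * q),
        0 < mu j + k * ((j < r)%N%:R * (l j * k)) &
        q * mu j - l j * k = l j * q + l j * k].
    (* Outside the first r indices nothing is coupled. *)
move=> j; have [jr|rj] := ltnP j r; last first.
    by exists 0, 0; rewrite !mulr0 mul0r !subr0 !addr0 ltr01 mu_gt0.
  pose i := Ordinal (leq_trans jr r_le_n); have ij : i = j :> nat by [].
  have [||k [q [k1 q1 kmu qk]]] := @coupling_exists R (l j) (mu j) _ (mu_le0 j jr).
  - by rewrite -(lE i).
  - by rewrite -(lE i) ?lambda_mu.
  exists k, q; split; rewrite ?mul1r.
  - by rewrite -expr2 subr_gt0.
  - by rewrite -expr2 subr_gt0.
  - by rewrite mulrCA -expr2.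
  - by lra.
have [KK DK] := isometric_gram (fdiag_adj V k) WW AW.
have cK : strictly_contractive (W *m fdiag V k).
  apply/strictly_contractiveP.
  rewrite KK !(fdiagM _ _ uV) (fdiag1 uV) fdiagN fdiagD.
  by apply/(posdefmx_fdiag _ uV) => j; case: (kq j).
exists (W *m fdiag V k); split=> //.
  exists A, (W *m fdiag V k), D; split=> //.
  rewrite DK DE !(fdiagM _ _ uV) fdiagD.
  by apply/(posdefmx_fdiag _ uV) => j; case: (kq j).
rewrite DE; apply: (similar_to_hermitian_coupling (proj1 A_posdef) uV WW AW
  (q := q)).
  by move=> j; case: (kq j).
by move=> j; case: (kq j).
Qed.
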